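(* Let $\mathcal{H}$ be a complex Hilbert space and let $A\in\mathcal{B}(\mathcal{H})$. Then $$\frac14\|A^*A+AA^*\|\le\frac12 w^2(A)+\frac18\left\|(A+A^* )^2(A-A^* )^2\right\|^{1/2}\le w^2(A).$$
   Context: $\mathcal{B}(\mathcal{H})$ is the set of bounded linear operators on $\mathcal{H}$, $A^*$ is the adjoint of $A$, and $\|\cdot\|$ is the operator norm. The numerical radius is $w(A)=\sup\{|\langle Ax,x\rangle| : x\in\mathcal{H},\ \|x\|=1\}$, and $w^2(A)=(w(A))^2$. *)

(* Defs.v *)
From HB Require Import structures.
From mathcomp Require Import all_boot all_order all_algebra complex.
From mathcomp Require Import all_classical all_reals all_analysis.

Set Implicit Arguments.
Unset Strict Implicit.
Unset Printing Implicit Defensive.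

Import Order.TTheory GRing.Theory Num.Theory.
Import numFieldNormedType.Exports.

Local Open Scope classical_set_scope.
Local Open Scope ring_scope.
Local Open Scope complex_scope.

Section HilbertOperators.
Variables (R : realType) (H : completeNormedModType R[i]).

(* A complex Hilbert space is a complete normed space over R[i] together with
   an inner product (linear in its first argument, conjugate-linear in its
   second one) that induces the norm. *)
Definition induces_norm (dot : {dot H for Num.conj}) : Prop :=
  forall x : H, `|x| ^+ 2 = dot x x.

Definition bounded_op (A : H -> H) : Prop :=
  exists M : R, forall x : H, `|A x| <= M%:C * `|x|.

(* Norms and moduli are elements of R[i] with zero imaginary part; complex.Re
   reads them in R, where suprema are available. *)
Definition opnorm (A : H -> H) : R :=
  sup [set complex.Re `|A x| | x in [set x : H | `|x| <= 1]].

(* On the zero space this is sup set0 = 0. *)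
Definition numerical_radius (dot : {dot H for Num.conj}) (A : H -> H) : R :=
  sup [set complex.Re `|dot (A x) x| | x in [set x : H | `|x| = 1]].

(* adjoint dot A y is the vector z such that <A x, y> = <x, z> for all x.
   It is unique by definiteness; it exists, by the Riesz representation
   theorem, as soon as A is linear and bounded (0 is a dummy value used only
   when there is none). *)
Definition adjoint (dot : {dot H for Num.conj}) (A : H -> H) : H -> H :=
  fun y => xget 0 [set z : H | forall x : H, dot (A x) y = dot x z].

End HilbertOperators.

(* Main.v *)
(** Let B be the adjoint of A and write S = A + B, D = A - B, C = iD. Both S and C
are self-adjoint with numerical radius, hence norm, at most 2w(A), while
AB + BA = (S^2 + C^2)/2 and S^2 D^2 = - S^2 C^2. The second inequality is then
immediate. The first one is
||S^2 + C^2|| <= max(||S||, ||C||)^2 + ||S^2 C^2||^(1/2): for z = (S^2 + C^2) x,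
expanding ||z||^2 = ||S(Sx) + C(Cx)||^2 bounds it by
(max(||S||, ||C||)^2 + ||SC||) (||Sx||^2 + ||Cx||^2), whose last factor is
<z, x>; moreover ||SC||^2 = ||C S^2 C|| is the spectral radius of C S^2 C, hence
of S^2 C^2, hence at most ||S^2 C^2||. *)
Require Import Defs.
From HB Require Import structures.
From mathcomp Require Import all_boot all_order all_algebra complex.
From mathcomp Require Import all_classical all_reals all_analysis.
From mathcomp Require Import ring lra.
Import Order.TTheory GRing.Theory Num.Theory.
Import numFieldNormedType.Exports.
Local Open Scope ring_scope.
Local Open Scope complex_scope.

(** If p < r, the sequence K (p/r)^n tends to 0 while staying at least r > 0. *)
Lemma expr_growth_le (R : realType) (r p K : R) : 0 <= p ->
  (forall n, r ^+ n.+1 <= K * p ^+ n) -> r <= p.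
Proof.
move=> p0 h; rewrite leNgt; apply/negP => pr.
have r0 : 0 < r by exact: le_lt_trans pr.
have z1 : `|p / r| < 1.
  by rewrite ger0_norm ?divr_ge0 ?(ltW r0) // ltr_pdivrMr // mul1r.
have : r <= 0.
  rewrite -(cvg_lim _ (cvg_geometric K z1)) //; apply: limr_ge.
    by apply/cvg_ex; exists 0; exact: cvg_geometric.
  apply: nearW => n /=.
  rewrite expr_div_n mulrA ler_pdivlMr ?exprn_gt0 // -exprS; exact: h.
by rewrite leNgt r0.
Qed.

(** * The underlying real inner product space *)

Section RealForm.
Variables (R : realType) (H : completeNormedModType R[i]).
Variables (dot : {dot H for Num.conj}).
Hypothesis dot_norm : induces_norm dot.

(** Real parts keep all inequalities in [R]; the imaginary part of [dot] is recovered through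
    multiplication by ['i], as in [Im_dot]. *)
Definition rdot (x y : H) : R := complex.Re (dot x y).
Definition rnorm (x : H) : R := complex.Re `|x|.

Lemma rnormE x : `|x| = (rnorm x)%:C.
Proof. by rewrite /rnorm RRe_real ?normr_real. Qed.

Lemma rnorm_ge0 x : 0 <= rnorm x.
Proof. by rewrite -ler0c -rnormE. Qed.

Lemma sqr_rnorm x : rnorm x ^+ 2 = rdot x x.
Proof. by rewrite /rdot -dot_norm rnormE -rmorphXn. Qed.

Lemma dotC x y : dot y x = (dot x y)^*.
Proof. by rewrite (hermC dot) expr0 mul1r. Qed.

Lemma rdotC x y : rdot y x = rdot x y.
Proof. by rewrite /rdot dotC; case: (dot x y). Qed.

Lemma rdotDl x y z : rdot (x + y) z = rdot x z + rdot y z.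
Proof. by rewrite /rdot linearDl raddfD. Qed.

Lemma rdotDr x y z : rdot z (x + y) = rdot z x + rdot z y.
Proof. by rewrite /rdot linearDr raddfD. Qed.

Lemma rdotNl x z : rdot (- x) z = - rdot x z.
Proof. by rewrite /rdot linearNl raddfN. Qed.

Lemma rdotNr x z : rdot z (- x) = - rdot z x.
Proof. by rewrite /rdot linearNr raddfN. Qed.

Lemma rdotZl (r : R) x z : rdot (r%:C *: x) z = r * rdot x z.
Proof.
by rewrite /rdot linearZl_LR /=; case: (dot x z) => a b; rewrite /= mul0r subr0.
Qed.

Lemma rdotZr (r : R) x z : rdot z (r%:C *: x) = r * rdot z x.
Proof. by rewrite rdotC rdotZl rdotC. Qed.

Lemma dot_iR x y : dot x ('i *: y) = - 'i * dot x y.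
Proof.
rewrite linearZr_LR /=; congr (_ * _).
by apply/eqP; rewrite eq_complex /= oppr0 !eqxx.
Qed.

Lemma Im_dot x y : complex.Im (dot x y) = rdot x ('i *: y).
Proof.
rewrite /rdot dot_iR; case: (dot x y) => a b /=.
by rewrite oppr0 mul0r sub0r mulN1r opprK.
Qed.

Lemma rdot_iL x y : rdot ('i *: x) y = - complex.Im (dot x y).
Proof.
rewrite /rdot linearZl_LR /=; case: (dot x y) => a b.
by rewrite /= mul0r mul1r sub0r.
Qed.

Lemma rdot_iC x y : rdot ('i *: x) y = - rdot x ('i *: y).
Proof. by rewrite rdot_iL Im_dot. Qed.

Lemma rdot_inj x y : (forall z, rdot z x = rdot z y) -> x = y.
Proof.
move=> h; apply/eqP; rewrite -subr_eq0 -normr_eq0 rnormE.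
have : rnorm (x - y) ^+ 2 = 0 by rewrite sqr_rnorm rdotDr rdotNr h subrr.
by move=> /eqP; rewrite sqrf_eq0 => /eqP ->.
Qed.

Lemma dot_inj x y : (forall z, dot z x = dot z y) -> x = y.
Proof. by move=> h; apply: rdot_inj => z; rewrite /rdot h. Qed.

Lemma rnormZ (r : R) x : rnorm (r%:C *: x) = `|r| * rnorm x.
Proof.
rewrite /rnorm normrZ rnormE normc_def /= expr0n addr0 sqrtr_sqr.
by rewrite mul0r subr0.
Qed.

Lemma rnormN x : rnorm (- x) = rnorm x.
Proof. by rewrite /rnorm normrN. Qed.

Lemma rnorm_i x : rnorm ('i *: x) = rnorm x.
Proof.
by rewrite /rnorm normrZ normc_def /= expr0n expr1n add0r sqrtr1 mul1r.
Qed.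

Lemma rnorm_eq0 x : rnorm x = 0 -> x = 0.
Proof. by move=> h; apply/eqP; rewrite -normr_eq0 rnormE h. Qed.

Lemma sqr_rnormD x y :
  rnorm (x + y) ^+ 2 = rnorm x ^+ 2 + 2 * rdot x y + rnorm y ^+ 2.
Proof. rewrite !sqr_rnorm !(rdotDl, rdotDr) (rdotC x y); ring. Qed.

(** Cauchy-Schwarz: the square of the norm of ||y|| x - ||x|| y equals 2 ||x|| ||y|| (||x|| ||y|| -
    <x, y>). *)
Lemma rdot_le x y : rdot x y <= rnorm x * rnorm y.
Proof.
have [y0|yn0] := eqVneq (rnorm y) 0.
  by rewrite y0 mulr0 (rnorm_eq0 y y0) /rdot linear0r.
have yp : 0 < rnorm y by rewrite lt0r yn0 rnorm_ge0.
have [x0|xn0] := eqVneq (rnorm x) 0.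
  by rewrite x0 mul0r (rnorm_eq0 x x0) /rdot linear0l.
have xp : 0 < rnorm x by rewrite lt0r xn0 rnorm_ge0.
have := sqr_ge0 (rnorm ((rnorm y)%:C *: x + - ((rnorm x)%:C *: y))).
rewrite sqr_rnormD rnormN !rnormZ rdotNr rdotZl rdotZr !ger0_norm ?rnorm_ge0 //.
have xyp : 0 < rnorm x * rnorm y by exact: mulr_gt0.
move=> h; rewrite -(ler_pM2l xyp); lra.
Qed.

Lemma normr_rdot_le x y : `|rdot x y| <= rnorm x * rnorm y.
Proof.
by rewrite ler_norml rdot_le lerNl -rdotNl -(rnormN x) rdot_le.
Qed.

(** * Symmetric maps: numerical bounds and growth of iterates *)

Definition rsym (T : H -> H) := forall x y, rdot (T x) y = rdot x (T y).

(** Here and in the next two lemmas, real linearity comes from moving [T] across [rdot], which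
    separates points. *)
Lemma rsymD T : rsym T -> {morph T : x y / x + y}.
Proof.
by move=> sT x y; apply: rdot_inj => z; rewrite rdotDr -!sT rdotDr.
Qed.

Lemma rsymN T : rsym T -> {morph T : x / - x}.
Proof.
by move=> sT x; apply: rdot_inj => z; rewrite rdotNr -!sT rdotNr.
Qed.

Lemma rsymZ T : rsym T -> forall (r : R) x, T (r%:C *: x) = r%:C *: T x.
Proof.
by move=> sT r x; apply: rdot_inj => z; rewrite rdotZr -!sT rdotZr.
Qed.

(* polarization, applied to the pair (x, m^-1 T x) *)
Lemma rsym_bound T m : rsym T -> 0 <= m ->
    (forall x, `|rdot (T x) x| <= m * rnorm x ^+ 2) ->
  forall x, rnorm (T x) <= m * rnorm x.
Proof.
move=> sT m0 hm x.
(* Subtracting the forms at x + y and x - y leaves 4 <Tx, y>; the parallelogram law evaluates the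
   sum of the two bounds. *)
have pol (y : H) : 2 * rdot (T x) y <= m * (rnorm x ^+ 2 + rnorm y ^+ 2).
  have := hm (x + y); have := hm (x - y).
  rewrite !sqr_rnormD !rsymD // rsymN // rnormN.
  rewrite !(rdotDl, rdotDr, rdotNl, rdotNr).
  rewrite !ler_norml => /andP[h1 _] /andP[_ h2].
  by have := sT y x; rewrite (rdotC (T x)) => E; lra.
rewrite -(@ler_pXn2r _ 2) ?nnegrE ?mulr_ge0 ?rnorm_ge0 // exprMn.
move: m0; rewrite le_eqVlt => /orP[/eqP m0|mp].
  by have := pol (T x); rewrite -sqr_rnorm -m0; lra.
have := pol ((m^-1)%:C *: T x).
rewrite rdotZr -sqr_rnorm rnormZ ger0_norm ?invr_ge0 ?(ltW mp) // exprMn.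
set a := rnorm (T x) ^+ 2; set b := rnorm x ^+ 2 => h.
have := ler_wpM2l (ltW mp) h.
have -> : m * (2 * (m^-1 * a)) = 2 * a by field; exact: lt0r_neq0.
have -> : m * (m * (b + m^-1 ^+ 2 * a)) = m ^+ 2 * b + a.
  by field; exact: lt0r_neq0.
lra.
Qed.

(** With a_n = ||T^n x||, symmetry and Cauchy-Schwarz give a_(n+1)^2 <= a_n a_(n+2). The ratios
    a_(n+1)/a_n thus increase from a_1/a_0; denominators are cleared to allow zeros. *)
Lemma rsym_iter_logconvex T x n : rsym T ->
  rnorm (T x) * rnorm (iter n T x) <= rnorm (iter n.+1 T x) * rnorm x.
Proof.
move=> sT; elim: n => [//|n IH].
set u := iter n T x in IH *; rewrite !iterS -/u in IH *.
have [Tu0|Tu0] := eqVneq (rnorm (T u)) 0.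
  by rewrite Tu0 mulr0 mulr_ge0 // rnorm_ge0.
have Tup : 0 < rnorm (T u) by rewrite lt0r Tu0 rnorm_ge0.
have C : rnorm (T u) ^+ 2 <= rnorm u * rnorm (T (T u)).
  by rewrite sqr_rnorm // sT rdot_le.
rewrite -(ler_pM2r Tup).
have := ler_wpM2l (rnorm_ge0 (T x)) C.
have := ler_wpM2r (rnorm_ge0 (T (T u))) IH.
lra.
Qed.

Lemma rsym_iter_ge T x n : rsym T ->
  rnorm (T x) ^+ n * rnorm x <= rnorm (iter n T x) * rnorm x ^+ n.
Proof.
move=> sT; elim: n => [|n IH]; first by rewrite expr0 mul1r mulr1.
have := ler_wpM2l (rnorm_ge0 (T x)) IH.
have := ler_wpM2r (exprn_ge0 n (rnorm_ge0 x)) (rsym_iter_logconvex T x n sT).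
rewrite !exprS; lra.
Qed.

(** The norm of a symmetric map is its spectral radius: ||T^n x|| grows at least like
    (||Tx||/||x||)^n, and [expr_growth_le] discards the constant [K]. *)
Lemma rsym_bound_of_iter T K q : rsym T -> 0 <= q ->
    (forall n x, rnorm (iter n.+1 T x) <= K * q ^+ n * rnorm x) ->
  forall x, rnorm (T x) <= q * rnorm x.
Proof.
move=> sT q0 hT x.
have [x0|xn0] := eqVneq (rnorm x) 0.
  by have := hT 0 x; rewrite x0 !mulr0.
have xp : 0 < rnorm x by rewrite lt0r xn0 rnorm_ge0.
apply: (@expr_growth_le _ _ _ (K * rnorm x)); first by rewrite mulr_ge0 // ltW.
move=> n; rewrite -(ler_pM2r xp).
apply: le_trans (rsym_iter_ge T x n.+1 sT) _.
have := ler_wpM2r (exprn_ge0 n.+1 (ltW xp)) (hT n x).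
rewrite exprMn exprS; lra.
Qed.

(** * The norm of P^2 + Q^2 for two symmetric maps *)

Section Pair.
Variables (P Q : H -> H) (m q : R).
Hypotheses (sP : rsym P) (sQ : rsym Q) (m0 : 0 <= m) (q0 : 0 <= q).
Hypotheses (bP : forall x, rnorm (P x) <= m * rnorm x).
Hypotheses (bQ : forall x, rnorm (Q x) <= m * rnorm x).
Hypotheses (bPQ : forall x, rnorm (P (P (Q (Q x)))) <= q * rnorm x).

(* ||PQ||^2 = ||QP^2Q|| is the spectral radius of QP^2Q, hence of P^2Q^2; it is
   estimated through (QP^2Q)^(n+1) = Q (P^2Q^2)^n P^2Q. *)
Lemma rnorm_comp_sqr x : rnorm (P (Q x)) ^+ 2 <= q * rnorm x ^+ 2.
Proof.
pose X y := Q (P (P (Q y))); pose Y y := P (P (Q (Q y))).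
have sX : rsym X by move=> u v; rewrite /X sQ !sP sQ.
have iterX n y : iter n.+1 X y = Q (iter n Y (P (P (Q y)))).
  by elim: n => [//|n IH]; rewrite iterS IH.
have iterY n y : rnorm (iter n Y y) <= q ^+ n * rnorm y.
  elim: n => [|n IH]; first by rewrite mul1r.
  rewrite iterS exprS -mulrA; apply: le_trans (bPQ _) _; exact: ler_wpM2l.
(* The factor m^4 pays for the four maps around [iter n Y]: [Q] on the left and [P], [P], [Q] on the
   right. *)
have bX : forall y, rnorm (X y) <= q * rnorm y.
  apply: (@rsym_bound_of_iter _ (m ^+ 4)) => // n y.
  rewrite iterX; apply: le_trans (bQ _) _.
  have -> : m ^+ 4 * q ^+ n * rnorm y
    = m * (q ^+ n * (m * (m * (m * rnorm y)))) by ring.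
  apply: ler_wpM2l => //; apply: le_trans (iterY _ _) _.
  apply: ler_wpM2l; first exact: exprn_ge0.
  apply: le_trans (bP _) _; apply: ler_wpM2l => //.
  by apply: le_trans (bP _) _; apply: ler_wpM2l.
have -> : rnorm (P (Q x)) ^+ 2 = rdot (X x) x.
  by rewrite sqr_rnorm sP rdotC -sQ.
rewrite expr2 mulrA.
by apply: le_trans (rdot_le _ _) _ => //; rewrite ler_wpM2r ?rnorm_ge0.
Qed.

Lemma rnorm_sqrD x :
  rnorm (P (P x) + Q (Q x)) <= (m ^+ 2 + Num.sqrt q) * rnorm x.
Proof.
set s := Num.sqrt q.
have s0 : 0 <= s by exact: sqrtr_ge0.
have PQ y : rnorm (P (Q y)) <= s * rnorm y.
  rewrite -(@ler_pXn2r _ 2) ?nnegrE ?mulr_ge0 ?rnorm_ge0 //.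
  by rewrite exprMn sqr_sqrtr // rnorm_comp_sqr.
have sqb T y : (forall x, rnorm (T x) <= m * rnorm x) ->
    rnorm (T y) ^+ 2 <= m ^+ 2 * rnorm y ^+ 2.
  by move=> bT; rewrite -exprMn ler_pXn2r ?nnegrE ?mulr_ge0 ?rnorm_ge0.
(* The cross term 2 <Pu, Qv> = 2 <u, PQv> is at most 2s ||u|| ||v||, hence at most s (||u||^2 +
   ||v||^2). *)
have row u v : rnorm (P u + Q v) ^+ 2
    <= (m ^+ 2 + s) * (rnorm u ^+ 2 + rnorm v ^+ 2).
  rewrite sqr_rnormD //.
  have h1 := sqb P u bP; have h2 := sqb Q v bQ.
  have h3 : rdot (P u) (Q v) <= rnorm u * (s * rnorm v).
    rewrite sP; apply: le_trans (rdot_le _ _) _ => //.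
    by apply: ler_wpM2l; rewrite ?rnorm_ge0.
  have := mulr_ge0 s0 (sqr_ge0 (rnorm u - rnorm v)); lra.
set z := P (P x) + Q (Q x).
have E : rnorm (P x) ^+ 2 + rnorm (Q x) ^+ 2 = rdot z x.
  by rewrite !sqr_rnorm // rdotDl -sP -sQ.
have zz : rnorm z ^+ 2 <= (m ^+ 2 + s) * (rnorm z * rnorm x).
  apply: le_trans (row _ _) _; rewrite E; apply: ler_wpM2l; last exact: rdot_le.
  by rewrite addr_ge0 // sqr_ge0.
have [z0|zn0] := eqVneq (rnorm z) 0.
  by rewrite z0 mulr_ge0 ?rnorm_ge0 // addr_ge0 // sqr_ge0.
have zp : 0 < rnorm z by rewrite lt0r zn0 rnorm_ge0.
rewrite -(ler_pM2l zp); lra.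
Qed.

End Pair.

(** * The modulus in coordinates and the Riesz representation theorem *)

Lemma Re_normc (z : R[i]) :
  complex.Re `|z| = Num.sqrt (complex.Re z ^+ 2 + complex.Im z ^+ 2).
Proof. by rewrite normc_def. Qed.

(* J x below is ||x - z||^2 - ||z||^2 for the vector z sought, so the parallelogram
   law makes its minimizing sequences Cauchy. *)
Lemma riesz (f : H -> R) (K : R) :
    {morph f : x y / x + y} -> (forall (r : R) x, f (r%:C *: x) = r * f x) ->
    (forall x, f x <= K * rnorm x) ->
  exists z, forall x, f x = rdot x z.
Proof.
move=> fD fZ fK.
pose J x := rnorm x ^+ 2 - 2 * f x.
pose E := range J.
have hE : has_lbound E.
  exists (- K ^+ 2) => _ [x _ <-]; rewrite /J.
  have := fK x; have := sqr_ge0 (rnorm x - K); lra.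
have dJ x : inf E <= J x by apply: ge_inf => //; exists x.
have hiE : has_inf E by split => //; exists (J 0), 0.
have /choice[u uJ] (n : nat) : exists x, J x < inf E + n.+1%:R^-1.
  have n0 : 0 < n.+1%:R^-1 :> R by rewrite invr_gt0.
  by have [_ [x _ <-] hx] := inf_adherent n0 hiE; exists x.
(* By the parallelogram law the left side is 2 J(u_n) + 2 J(u_m) - 4 J(midpoint), and J(midpoint) is
   at least the infimum. *)
have uu n m : rnorm (u n - u m) ^+ 2 <= 2 * n.+1%:R^-1 + 2 * m.+1%:R^-1.
  have := dJ ((2^-1)%:C *: (u n + u m)); rewrite /J rnormZ fZ fD exprMn.
  rewrite ger0_norm ?invr_ge0 ?ler0n //.
  have := uJ n; have := uJ m; rewrite /J !sqr_rnormD !rnormN rdotNr.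
  by move: (n.+1%:R^-1) (m.+1%:R^-1) (inf E) => a b d; lra.
have inv_le n m : (n <= m)%N -> m.+1%:R^-1 <= n.+1%:R^-1 :> R.
  by move=> nm; rewrite lef_pV2 ?posrE ?ltr0n // ler_nat.
have small (e : R) : 0 < e -> exists N, N.+1%:R^-1 < e :> R.
  by move=> e0; have [N] := ltr_add_invr e0; rewrite add0r; exists N.
have u_cauchy : cauchy (u @ \oo)%classic.
  apply: cauchy_exP => eps eps0.
  have eR : (complex.Re eps)%:C = eps by rewrite RRe_real // gtr0_real.
  have e0 : 0 < complex.Re eps by rewrite -ltcR eR.
  have [|N hN] := small (complex.Re eps ^+ 2 / 4).
    by rewrite divr_gt0 ?exprn_gt0.
  exists (u N); exists N => // n /= Nn.
  rewrite -ball_normE /= -eR rnormE ltcR.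
  rewrite -(@ltr_pXn2r _ 2) ?nnegrE ?rnorm_ge0 ?(ltW e0) //.
  have := uu N n; have := inv_le _ _ Nn.
  by move: (n.+1%:R^-1) (N.+1%:R^-1) hN => a b; lra.
have u_cvg := cauchy_cvg _ u_cauchy.
set z := lim (u @ \oo)%classic in u_cvg.
exists z => h; apply/eqP; rewrite -subr_eq0; apply/negPn/negP => g0.
have hn0 : rnorm h != 0.
  apply: contra g0 => /eqP /rnorm_eq0 ->; rewrite /rdot linear0l subr0.
  by have := fZ 0 0; rewrite scaler0 mul0r => ->.
have hp : 0 < rnorm h by rewrite lt0r hn0 rnorm_ge0.
(* The choice t = c / ||h||^2 minimizes J(u_n + t h), whose value is then J(u_n) - c^2 / ||h||^2; it
   cannot fall below the infimum. *)
have c_le n : (f h - rdot h (u n)) ^+ 2 <= n.+1%:R^-1 * rnorm h ^+ 2.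
  set c := f h - _; pose t := c / rnorm h ^+ 2.
  have := dJ (u n + t%:C *: h); have := uJ n.
  rewrite /J sqr_rnormD rdotZr fD fZ rnormZ exprMn.
  rewrite real_normK ?num_real // (rdotC h).
  have -> : f h = c + rdot h (u n) by rewrite /c subrK.
  have tE : t * rnorm h ^+ 2 = c by rewrite /t divfK // expf_neq0.
  have tc : t ^+ 2 * rnorm h ^+ 2 = t * c by rewrite expr2 -mulrA tE.
  have cc : t * c * rnorm h ^+ 2 = c ^+ 2 by rewrite mulrAC tE expr2.
  rewrite tc => h1 h2.
  have h3 : t * c <= n.+1%:R^-1.
    move: (n.+1%:R^-1) (inf E) h1 h2 => a d h1 h2; lra.
  by rewrite -cc ler_wpM2r // sqr_ge0.
(* Half of the supposed gap is allotted to each of two errors: [u n] as an approximate representer,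
   and [u n] as an approximation of [z]. *)
have [e e0 eE] : exists2 e, 0 < e & 2 * (e * rnorm h) = `|f h - rdot h z|.
  exists (`|f h - rdot h z| / (2 * rnorm h)); last by field; exact: hn0.
  by rewrite divr_gt0 ?normr_gt0 // mulr_gt0.
have eh0 : 0 <= e * rnorm h by rewrite mulr_ge0 ?ltW.
have [N hN] := small (e ^+ 2) (exprn_gt0 2 e0).
have eC0 : 0 < e%:C by rewrite ltcR.
have u_to_z : (u @ \oo --> z)%classic by apply: u_cvg.
move/cvgrPdist_lt: u_to_z => /(_ _ eC0) [N' _ hN'].
pose n := maxn N N'.
have := hN' n (leq_maxr _ _); rewrite /= rnormE ltcR => zu.
have c1 : `|f h - rdot h (u n)| < e * rnorm h.
  rewrite -(@ltr_pXn2r _ 2) ?nnegrE ?normr_ge0 //.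
  rewrite real_normK ?num_real //; apply: le_lt_trans (c_le n) _.
  rewrite exprMn ltr_pM2r ?exprn_gt0 //; apply: le_lt_trans hN.
  by apply: inv_le; exact: leq_maxl.
have c2 : `|rdot h (z - u n)| < e * rnorm h.
  by apply: le_lt_trans (normr_rdot_le _ _) _; rewrite mulrC ltr_pM2r.
have : `|f h - rdot h z| < 2 * (e * rnorm h).
  have -> : f h - rdot h z = (f h - rdot h (u n)) - rdot h (z - u n).
    by rewrite rdotDr rdotNr; ring.
  apply: le_lt_trans (ler_normB _ _) _; rewrite mulr_natl mulr2n; exact: ltrD.
by rewrite eE ltxx.
Qed.

(** * The operator norm as a least bound *)

Lemma opnorm_le (T : H -> H) (M : R) : 0 <= M ->
  (forall x, rnorm (T x) <= M * rnorm x) -> opnorm T <= M.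
Proof.
move=> M0 hT; apply: ge_sup.
  by exists (rnorm (T 0)), 0; rewrite //= normr0.
move=> _ [x /= x1 <-]; apply: le_trans (hT x) _.
by rewrite rnormE lecR in x1; rewrite ler_piMr.
Qed.

(** The bound [M] makes the supremum in [opnorm] a genuine one; homogeneity then reduces any vector
    to the unit ball. *)
Lemma opnorm_ub (T : H -> H) (M : R) :
    (forall (r : R) x, T (r%:C *: x) = r%:C *: T x) -> 0 <= M ->
    (forall x, rnorm (T x) <= M * rnorm x) ->
  0 <= opnorm T /\ forall x, rnorm (T x) <= opnorm T * rnorm x.
Proof.
move=> TZ M0 hT.
have ub x : rnorm x <= 1 -> rnorm (T x) <= opnorm T.
  move=> x1; apply: ub_le_sup; last by exists x; rewrite //= rnormE lecR.
  exists M => _ [y /= y1 <-]; apply: le_trans (hT y) _.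
  by rewrite rnormE lecR in y1; rewrite ler_piMr.
split.
  by apply: le_trans (rnorm_ge0 (T 0)) (ub 0 _); rewrite /rnorm normr0 ler01.
move=> x; have [x0|xn0] := eqVneq (rnorm x) 0.
  by have := hT x; rewrite x0 !mulr0.
have xp : 0 < rnorm x by rewrite lt0r xn0 rnorm_ge0.
have := ub ((rnorm x)^-1%:C *: x).
rewrite TZ !rnormZ ger0_norm ?invr_ge0 ?rnorm_ge0 // mulVf // => /(_ (lexx _)).
by rewrite ler_pdivrMl // mulrC.
Qed.

(** * The adjoint and the numerical radius of a bounded operator *)

Section Adjoint.
Variables (A : {linear H -> H}) (M : R).
Hypothesis bA : forall x, rnorm (A x) <= M * rnorm x.

Local Notation A' := (adjoint dot A).
Local Notation w := (numerical_radius dot A).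

Lemma adjointP x y : dot (A x) y = dot x (A' y).
Proof.
suff /xgetPex h : exists z, forall x, dot (A x) y = dot x z by exact: h.
have [||v|z hz] := @riesz (fun v => rdot (A v) y) (M * rnorm y).
- by move=> u v; rewrite linearD rdotDl.
- by move=> r v; rewrite linearZ rdotZl.
- apply: le_trans (rdot_le _ _) _.
  by rewrite mulrAC ler_wpM2r ?rnorm_ge0.
(* Riesz represents only the real part; evaluating at ['i *: v] and using complex linearity of [A]
   yields the imaginary part. *)
exists z => v; apply/eqP; rewrite eq_complex; apply/andP; split; apply/eqP.
  exact: hz.
by apply: oppr_inj; rewrite -!rdot_iL -linearZ hz.
Qed.

Lemma adjointPr x y : dot (A' x) y = dot x (A y).
Proof. by rewrite dotC -adjointP -dotC. Qed.

Lemma rdot_adjoint x y : rdot (A x) y = rdot x (A' y).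
Proof. by rewrite /rdot adjointP. Qed.

Lemma adjointD : {morph A' : x y / x + y}.
Proof.
by move=> x y; apply: rdot_inj => z; rewrite rdotDr -!rdot_adjoint rdotDr.
Qed.

Lemma adjointN : {morph A' : x / - x}.
Proof.
by move=> x; apply: rdot_inj => z; rewrite rdotNr -!rdot_adjoint rdotNr.
Qed.

Lemma adjointZ c x : A' (c *: x) = c *: A' x.
Proof.
apply: dot_inj => z; rewrite -adjointP linearZr_LR [RHS]linearZr_LR /=.
by rewrite adjointP.
Qed.

Lemma numerical_radius_ub x : rnorm x = 1 -> complex.Re `|dot (A x) x| <= w.
Proof.
move=> x1; apply: ub_le_sup; last by exists x; rewrite //= rnormE x1.
(* A crude bound that makes the supremum finite: real and imaginary parts are each at most [M] in
   absolute value. *)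
exists (2 * M) => _ [y y1 <-].
have ry : rnorm y = 1 by rewrite /rnorm (y1 : `|y| = 1).
have := bA y; rewrite ry mulr1 => Ay.
rewrite Re_normc.
have h1 : `|rdot (A y) y| <= M.
  by apply: le_trans (normr_rdot_le _ _) _; rewrite ry mulr1.
have h2 : `|rdot (A y) ('i *: y)| <= M.
  by apply: le_trans (normr_rdot_le _ _) _; rewrite rnorm_i ry mulr1.
rewrite Im_dot -/(rdot (A y) y).
have M0 : 0 <= M by exact: le_trans (normr_ge0 _) h1.
rewrite -(@ler_pXn2r _ 2) ?nnegrE ?sqrtr_ge0 ?mulr_ge0 //.
rewrite sqr_sqrtr ?addr_ge0 ?sqr_ge0 //.
have sq (a : R) : `|a| <= M -> a ^+ 2 <= M ^+ 2.
  by move=> aM; rewrite -[a ^+ 2]real_normK ?num_real // ler_pXn2r ?nnegrE.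
have := sq _ h1; have := sq _ h2; have := sqr_ge0 M; rewrite exprMn; lra.
Qed.

Lemma numerical_radius_ge0 : 0 <= w.
Proof.
have [[x x1]|nx] := pselect (exists x : H, rnorm x = 1).
  apply: le_trans (numerical_radius_ub x x1); by rewrite Re_normc sqrtr_ge0.
(* Without unit vectors the supremum is over the empty set, with default value 0. *)
rewrite /numerical_radius (_ : [set _ | _ in _]%classic = set0) ?sup0 //.
apply/seteqP; split => // _ [x /= x1 _].
by apply: nx; exists x; rewrite /rnorm x1.
Qed.

Lemma numerical_radius_bound x :
  `|rdot (A x) x| <= w * rnorm x ^+ 2
  /\ `|complex.Im (dot (A x) x)| <= w * rnorm x ^+ 2.
Proof.
have [x0|xn0] := eqVneq (rnorm x) 0.
  rewrite (rnorm_eq0 x x0) /rdot linear0r normr0.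
  by rewrite mulr_ge0 ?numerical_radius_ge0 ?sqr_ge0.
have xp : 0 < rnorm x by rewrite lt0r xn0 rnorm_ge0.
pose y := (rnorm x)^-1%:C *: x.
have y1 : rnorm y = 1 by rewrite rnormZ ger0_norm ?invr_ge0 ?rnorm_ge0 // mulVf.
have xE : x = (rnorm x)%:C *: y.
  by rewrite /y scalerA -rmorphM divff // rmorph1 scale1r.
have E : dot (A x) x = (rnorm x ^+ 2)%:C * dot (A y) y.
  have dotZ (r : R) :
      dot (A (r%:C *: y)) (r%:C *: y) = (r ^+ 2)%:C * dot (A y) y.
    rewrite [A _]linearZ linearZl_LR /= linearZr_LR /= mulrA.
    rewrite rmorphXn expr2.
    by congr (_ * _ * _); exact: conjc_real.
  by rewrite -dotZ -xE.
have := numerical_radius_ub y y1; rewrite Re_normc => h.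
have R0 : 0 <= rnorm x ^+ 2 by exact: sqr_ge0.
rewrite /rdot E; move: (rnorm x ^+ 2) R0 => r R0.
case: (dot (A y) y) h => a b /= h.
rewrite !mul0r subr0 addr0 !normrM (ger0_norm R0) (mulrC _ r).
split; apply: ler_wpM2l => //; apply: le_trans h;
  rewrite -sqrtr_sqr; apply: ler_wsqrtr.
  by rewrite lerDl sqr_ge0.
by rewrite lerDr sqr_ge0.
Qed.

(** * Self-adjoint parts of [A] *)

Definition re_part x := A x + A' x.
(** For the Cartesian decomposition A = X + iY this is -2Y, while [re_part] is 2X; the factor ['i]
    makes the skew-adjoint difference symmetric. *)
Definition im_part x := 'i *: (A x - A' x).

Lemma rdot_adjointr x y : rdot (A' x) y = rdot x (A y).
Proof. by rewrite /rdot adjointPr. Qed.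

Lemma rsym_re_part : rsym re_part.
Proof.
move=> x y; rewrite /re_part rdotDl rdotDr rdot_adjoint rdot_adjointr.
exact: addrC.
Qed.

Lemma rsym_im_part : rsym im_part.
Proof.
move=> x y; rewrite /im_part rdot_iC rdotDl rdotNl rdot_adjoint rdot_adjointr.
by rewrite adjointZ [A _]linearZ scalerBr rdotDr rdotNr opprB.
Qed.

(** The quadratic form of [re_part] is 2 Re <Ay, y>, so [rsym_bound] turns the numerical radius into
    a norm bound. *)
Lemma re_part_bound x : rnorm (re_part x) <= 2 * w * rnorm x.
Proof.
apply: rsym_bound; first exact: rsym_re_part.
  by rewrite mulr_ge0 ?numerical_radius_ge0.
move=> y; rewrite /re_part rdotDl rdot_adjointr (rdotC (A y)).
have -> : rdot (A y) y + rdot (A y) y = 2 * rdot (A y) y by ring.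
rewrite normrM ger0_norm // -mulrA ler_pM2l //.
by have [] := numerical_radius_bound y.
Qed.

(** Same argument, with quadratic form -2 Im <Ay, y>. *)
Lemma im_part_bound x : rnorm (im_part x) <= 2 * w * rnorm x.
Proof.
apply: rsym_bound; first exact: rsym_im_part.
  by rewrite mulr_ge0 ?numerical_radius_ge0.
move=> y; rewrite /im_part rdot_iL linearBl raddfB /= adjointPr (dotC (A y)).
have -> : complex.Im (dot (A y) y)^* = - complex.Im (dot (A y) y).
  by case: (dot (A y) y).
rewrite (_ : - _ = 2 * - complex.Im (dot (A y) y)); last by ring.
rewrite normrM normrN ger0_norm // -mulrA ler_pM2l //.
by have [] := numerical_radius_bound y.
Qed.

Lemma im_part_sqr x :
  im_part (im_part x) = - (A (A x - A' x) - A' (A x - A' x)).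
Proof.
rewrite /im_part [A (_ *: _)]linearZ adjointZ /= -scalerBr scalerA.
have -> : 'i * 'i = -1 :> R[i] by rewrite -expr2 sqr_i.
by rewrite scaleN1r.
Qed.

(** As [im_part] squares to -(A - A')^2, the terms A^2 and A'^2 cancel and the mixed products
    double. *)
Lemma re_im_part_sqr x :
  A' (A x) + A (A' x)
    = (2^-1)%:C *: (re_part (re_part x) + im_part (im_part x)).
Proof.
rewrite im_part_sqr /re_part !adjointD adjointN !(linearD A) (linearN A).
by apply: rdot_inj => z; rewrite rdotZr !(rdotDr, rdotNr); field.
Qed.

(** * The two inequalities *)

Lemma numerical_radius_refinement :
  4^-1 * opnorm ((A' \o A) \+ (A \o A'))
    <= 2^-1 * w ^+ 2 + 8^-1 * Num.sqrt (opnorm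
         (((A \+ A') \o (A \+ A')) \o ((A \- A') \o (A \- A'))))
    <= w ^+ 2.
Proof.
set T := (X in Num.sqrt (opnorm X)).
have sS := rsym_re_part; have sC := rsym_im_part.
have TE x : T x = - re_part (re_part (im_part (im_part x))).
  by rewrite im_part_sqr !(rsymN _ sS) opprK.
have w0 := numerical_radius_ge0.
have w20 : 0 <= 2 * w by rewrite mulr_ge0.
(* This bound serves twice: it makes [opnorm T] finite for [opnorm_ub], and its square root 4 w^2
   gives the second inequality. *)
have bT x : rnorm (T x) <= (2 * w) ^+ 4 * rnorm x.
  rewrite TE rnormN.
  have -> : (2 * w) ^+ 4 * rnorm x
    = 2 * w * (2 * w * (2 * w * (2 * w * rnorm x))) by ring.
  do 3![apply: le_trans (re_part_bound _) _ ||
        apply: le_trans (im_part_bound _) _;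
        apply: ler_wpM2l => //].
  exact: im_part_bound.
have TZ (r : R) x : T (r%:C *: x) = r%:C *: T x.
  by rewrite !TE !(rsymZ _ sS, rsymZ _ sC) scalerN.
have [q0 bq] := opnorm_ub _ _ TZ (exprn_ge0 4 w20) bT.
set q := opnorm T in q0 bq *.
have bSC x : rnorm (re_part (re_part (im_part (im_part x)))) <= q * rnorm x.
  by rewrite -rnormN -TE.
have s0 := sqrtr_ge0 q.
apply/andP; split.
  (* [rnorm_sqrD] with m = 2w; a quarter of the right side is w^2/2 plus an eighth of the root of
     [q]. *)
  have : opnorm ((A' \o A) \+ (A \o A')) <= 2^-1 * ((2 * w) ^+ 2 + Num.sqrt q).
    apply: opnorm_le => [|x]; first by rewrite mulr_ge0 // addr_ge0 // sqr_ge0.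
    rewrite /= re_im_part_sqr rnormZ ger0_norm // -mulrA ler_wpM2l //.
    exact: (rnorm_sqrD _ _ _ _ sS sC w20 q0 re_part_bound im_part_bound bSC x).
  rewrite exprMn; lra.
have : Num.sqrt q <= (2 * w) ^+ 2.
  rewrite -(@ler_pXn2r _ 2) ?nnegrE ?sqr_ge0 // sqr_sqrtr // -exprM.
  by apply: opnorm_le _ bT; exact: exprn_ge0.
rewrite exprMn; lra.
Qed.

End Adjoint.
End RealForm.

Theorem theorem2p20 (R : realType) (H : completeNormedModType R[i])
    (dot : {dot H for Num.conj}) (dot_norm : induces_norm dot)
    (A : {linear H -> H}) (bndA : bounded_op A) :
  let A' := adjoint dot A in
  let S := A \+ A' in
  let D := A \- A' in
  4^-1 * opnorm ((A' \o A) \+ (A \o A'))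
    <= 2^-1 * numerical_radius dot A ^+ 2
       + 8^-1 * Num.sqrt (opnorm ((S \o S) \o (D \o D)))
    <= numerical_radius dot A ^+ 2.
Proof.
have [M hM] := bndA.
have bA x : rnorm _ _ (A x) <= M * rnorm _ _ x.
  by have := hM x; rewrite !rnormE -rmorphM lecR.
exact: (numerical_radius_refinement _ _ _ dot_norm _ M bA).
Qed.
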